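(* For a positive integer $\ell$, let $T_\ell^\delta$ denote the full $\delta$-ary tree of depth $\ell$. Let $n$ be the smallest positive integer (assumed to exist) such that there exist $\delta+1$ outer multiset bases $S_1,\ldots,S_{\delta+1}$ of $T_n^\delta$ satisfying, for all $i\ne j$ in $\{1,\ldots,\delta+1\}$, $$\operatorname{m}_{T_n^\delta}(w|S_i)[\epsilon_{T_n^\delta}(w)]\neq \operatorname{m}_{T_n^\delta}(w|S_j)[\epsilon_{T_n^\delta}(w)],$$ where $w$ is the root of $T_n^\delta$. Then, for every $\ell\ge n$, the outer multiset dimension of $T_\ell^\delta$ is given by $$\dim_{ms}(T_\ell^\delta)=\delta^{\ell-n}\times\dim_{ms}(T_n^\delta).$$
   Context: For a simple connected graph $G=(V,E)$, $d_G(u,v)$ is the length of a shortest $u$–$v$ path. For $S=\{w_1,\ldots,w_t\}\subseteq V$ and $u\in V$, the multiset representation of $u$ with respect to $S$ is the multiset $\operatorname{m}_G(u|S)$ consisting of $d_G(u,w_1),\ldots,d_G(u,w_t)$, counted with multiplicity. A set $S\subseteq V$ is an outer multiset resolving set of $G$ if $\operatorname{m}_G(u|S)\ne \operatorname{m}_G(v|S)$ for every two distinct vertices $u,v\in V\setminus S$. The outer multiset dimension $\dim_{ms}(G)$ is the minimum cardinality of an outer multiset resolving set of $G$, and an outer multiset basis is an outer multiset resolving set of minimum cardinality. For a multiset $M$ and an element $x$, $M[x]$ denotes the multiplicity of $x$ in $M$. $\epsilon_G(x)$ denotes the eccentricity of the vertex $x$ in $G$, i.e. the largest distance from $x$ to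 any vertex of $G$. A full $\delta$-ary tree is a rooted tree whose root has degree $\delta$, all of whose leaves are at the same distance from the root (this distance is the depth), and in which every vertex other than the root is either a leaf or a vertex of degree $\delta+1$. *)

(* Defs.v *)
From HB Require Import structures.
From mathcomp Require Import all_boot.
From mathcomp Require Import finmap multiset.

Set Implicit Arguments.
Unset Strict Implicit.
Unset Printing Implicit Defensive.

Record sgraph := SGraph {
  vert :> finType;
  adj : rel vert;
  adj_sym : symmetric adj;
  adj_irr : irreflexive adj
}.

Record rooted_graph := RootedGraph {
  rooted_sgraph :> sgraph;
  root_of : rooted_sgraph
}.

Section Graph.
Variable G : sgraph.
Implicit Types (u v x : G) (S : {set G}).

Definition is_path u v (p : seq G) : bool :=
  [&& path (@adj G) u p, last u p == v & uniq (u :: p)].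

(* A path has fewer than #|G| edges, so the default value #|G| of the minimum
   is only taken when u and v are not connected. *)
Definition dist u v : nat :=
  \big[minn/#|G|]_(k < #|G| | [exists p : k.-tuple G, is_path u v p]) k.

Definition ecc u : nat := \max_(v : G) dist u v.

Definition degree v : nat := #|[set u | adj v u]|.

Definition connected : Prop := forall u v, connect (@adj G) u v.

(* [:: x; y] is a ucycle as soon as x and y are adjacent. *)
Definition acyclic : Prop :=
  forall c : seq G, ucycle (@adj G) c -> size c <= 2.

Definition is_tree : Prop := connected /\ acyclic.

Definition mrep u S : {mset nat}%mset := seq_mset [seq dist u x | x in S].

Definition oms_resolving S : bool :=
  [forall u, forall v,
    [&& u \notin S, v \notin S & u != v] ==> (mrep u S != mrep v S)].

Lemma oms_resolvingT : oms_resolving [set: G].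
Proof. by apply/forallP => u; apply/forallP => v; rewrite in_setT. Qed.

Definition dim_ms : nat := #|[arg min_(S < [set: G] | oms_resolving S) #|S|]|.

Definition oms_basis S : bool := oms_resolving S && (#|S| == dim_ms).

Lemma dim_msP :
  (exists2 S, oms_resolving S & #|S| = dim_ms) /\
  (forall S, oms_resolving S -> dim_ms <= #|S|).
Proof.
rewrite /dim_ms; case: arg_minnP => [|S resS minS]; first exact: oms_resolvingT.
by split=> //; exists S.
Qed.

End Graph.

(* A leaf of a rooted tree is a vertex without children: its only neighbour is
   its parent, and the root has no parent. *)
Definition is_leaf (G : rooted_graph) (v : G) : bool :=
  degree v == (if v == root_of G then 0 else 1).

Definition full_ary_tree (delta l : nat) (G : rooted_graph) : Prop :=
  [/\ is_tree G,
      degree (root_of G) = delta,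
      (forall v : G, is_leaf v -> dist (root_of G) v = l) &
      (forall v : G, v != root_of G -> is_leaf v \/ degree v = delta.+1)].

Definition has_separated_bases (delta : nat) (G : rooted_graph) : Prop :=
  exists S : 'I_delta.+1 -> {set G},
    (forall i, oms_basis (S i)) /\
    (forall i j, i != j ->
       mrep (root_of G) (S i) (ecc (root_of G)) <>
       mrep (root_of G) (S j) (ecc (root_of G))).

(* Main.v *)
From mathcomp Require Import all_boot zify.
From mathcomp Require Import finmap multiset.
Require Import Defs.

Set Implicit Arguments.
Unset Strict Implicit.
Unset Printing Implicit Defensive.

(** Deleting the root of the full [delta]-ary tree of depth [l+1] leaves [delta]
copies ("branches") of the tree of depth [l].  For [delta >= 2], sibling leaves
cannot both be missed by a resolving set [S], so [S] contains leaves in every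
branch, and the largest distance from a vertex [x] to [S] is [depth x] plus the
height of the tree.  Hence representations determine depths.  Two vertices of the
same branch at the same depth see the other branches identically, so [S]
restricted to a branch is resolving there, whence
[dim T_{l+1} >= delta * dim T_l].
Conversely, gluing [delta] bases with pairwise distinct numbers of leaves is
resolving: two vertices at the same depth in branches [i <> j] are separated by
the multiplicity of their largest distance, which is the total number of leaves
minus that of their own branch.  Omitting in turn each of [delta+1] separated
bases yields [delta+1] separated bases of [T_{l+1}], and the induction goes on.
For [delta = 1] the tree is a path and the dimension is always 1. *)

(** * Words as vertices of the full tree *)

Section Words.
Variable delta : nat.

(* [None] is the root, and [Some (i, x)] is the vertex [x] of the i-th branch. *)
Fixpoint word (l : nat) : finType :=
  if l is l'.+1 then option ('I_delta * word l')%type else unit.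

Definition wroot l : word l :=
  match l return word l with 0 => tt | _.+1 => None end.

Fixpoint depth l : word l -> nat :=
  match l return word l -> nat with
  | 0 => fun=> 0
  | l'.+1 => fun x => if x is Some (_, x') then (depth x').+1 else 0
  end.

Fixpoint wdist l : word l -> word l -> nat :=
  match l return word l -> word l -> nat with
  | 0 => fun _ _ => 0
  | l'.+1 => fun x y =>
    match x, y with
    | Some (i, x'), Some (j, y') =>
      if i == j then wdist x' y' else (depth x' + depth y').+2
    | Some (_, x'), None => (depth x').+1
    | None, Some (_, y') => (depth y').+1
    | None, None => 0
    end
  end.

Fixpoint child l : word l -> word l -> bool :=
  match l return word l -> word l -> bool with
  | 0 => fun _ _ => false
  | l'.+1 => fun x y =>
    match x, y with
    | Some (i, x'), Some (j, y') => (i == j) && child x' y'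
    | None, Some (_, y') => y' == wroot l'
    | _, None => false
    end
  end.

Lemma depth_root l : depth (wroot l) = 0. Proof. by case: l. Qed.

Lemma depth_le l (x : word l) : depth x <= l.
Proof. by elim: l x => //= l IH [[i x]|] //=; rewrite ltnS. Qed.

Lemma wdistC l (x y : word l) : wdist x y = wdist y x.
Proof.
elim: l x y => //= l IH [[i x]|] [[j y]|] //=.
by rewrite eq_sym IH addnC.
Qed.

Lemma wdist_root l (x : word l) : wdist x (wroot l) = depth x.
Proof. by case: l x => //= l [[]|]. Qed.

Lemma wdist_refl l (x : word l) : wdist x x = 0.
Proof. by elim: l x => //= l IH [[i x]|] //; rewrite eqxx. Qed.

Lemma wdist_eq0 l (x y : word l) : wdist x y = 0 -> x = y.
Proof.
elim: l x y => [[][]|l IH [[i x]|] [[j y]|]] //=.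
by case: eqP => // -> /IH ->.
Qed.

Lemma wdist_le l (x y : word l) : wdist x y <= depth x + depth y.
Proof.
elim: l x y => //= l IH [[i x]|] [[j y]|] //=; rewrite ?addn0 //.
by case: ifP => _; [have := IH x y|]; lia.
Qed.

Lemma child_depth l (x y : word l) : child x y -> depth y = (depth x).+1.
Proof.
elim: l x y => //= l IH [[i x]|] [[j y]|] //=; first by case/andP=> _ /IH ->.
by move/eqP->; rewrite depth_root.
Qed.

(** Outside the branch of [x] every path runs through the root, so only the depth changes; inside
    it, induct. This later supplies the edge condition of [dist_unique]. *)
Lemma child_wdist l (x y z : word l) :
  child y z -> wdist x z = (wdist x y).+1 \/ wdist x y = (wdist x z).+1.
Proof.
elim: l x y z => //= l IH x [[i y]|] [[j z]|] //=.
  case/andP=> /eqP <- cyz; case: x => [[k x]|]; last first.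
    by rewrite (child_depth cyz); left.
  case: ifP => _; first exact: IH.
  by rewrite (child_depth cyz) addnS; left.
move/eqP->; case: x => [[k x]|]; last by rewrite depth_root; left.
by case: ifP => _; rewrite ?wdist_root ?depth_root ?addn0; [right|left].
Qed.

Lemma parent_ex l (y : word l) : y != wroot l -> exists z, child z y.
Proof.
elim: l y => [[]|l IH [[i y]|]] //= _.
have [->|/IH [z cz]] := eqVneq y (wroot l); first by exists None.
by exists (Some (i, z)); rewrite /= eqxx.
Qed.

Lemma wdist_pred l (x y : word l) : x != y ->
  exists2 z, child z y || child y z & (wdist x z).+1 = wdist x y.
Proof.
elim: l x y => [[][]|l IH x [[i y]|]] //= xy; last first.
  case: x xy => [[j x] _|] //.
  by exists (Some (j, wroot l)); rewrite /= eqxx // wdist_root.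
(* When [x] lies outside branch [i], every path from [x] to the target enters through the root, so
   the target's parent is the required neighbour. *)
have up : (if x is Some (j, _) then j != i else true) ->
    exists2 z : word l.+1, child z (Some (i, y) : word l.+1)
     || child (Some (i, y) : word l.+1) z &
     (wdist x z).+1 = wdist x (Some (i, y) : word l.+1).
  move=> xi; have [z cz] := @parent_ex l.+1 (Some (i, y)) isT.
  exists z; first by rewrite cz.
  have := cz; have := child_depth cz; move: z {cz} => z.
  case: x xi {xy} => [[j x] /= /negPf ij|_]; last first.
    by rewrite !(wdistC (None : word l.+1)) !(wdist_root (_ : word l.+1)) => ->.
  case: z => [[k z]|] /=; last by rewrite ij => -[->]; rewrite addn0.
  by move=> [->] /andP[/eqP-> _]; rewrite ij addnS.
case: x xy up => [[j x]|] xy up; last exact: up.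
have [ij|/eqP ij] := eq_comparable j i; last exact: up.
subst j; have xy' : x != y by apply: contra xy => /eqP->.
have [z cz dz] := IH x y xy'.
by exists (Some (i, z)); rewrite /= eqxx.
Qed.

(** * Representation multiplicities, branches and gluing *)

Definition wcnt l (x : word l) (S : {set word l}) d : nat :=
  \sum_(y in S) (wdist x y == d).

Definition wres l (S : {set word l}) : Prop :=
  forall x y, x \notin S -> y \notin S -> wcnt x S =1 wcnt y S -> x = y.

Definition branch l (S : {set word l.+1}) (i : 'I_delta) : {set word l} :=
  [set x | (Some (i, x) : word l.+1) \in S].

Definition glue l (S : 'I_delta -> {set word l}) : {set word l.+1} :=
  [set x : word l.+1 | if x is Some (i, x') then x' \in S i else false].

Definition leaves l (S : {set word l}) : nat := #|[set x in S | depth x == l]|.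

Lemma branch_glue l (S : 'I_delta -> {set word l}) i : branch (glue S) i = S i.
Proof. by apply/setP=> x; rewrite !inE. Qed.

Lemma big_word l (S : {set word l.+1}) (F : word l.+1 -> nat) :
  \sum_(x in S) F x =
  ((None : word l.+1) \in S) * F None
   + \sum_i \sum_(x in branch S i) F (Some (i, x)).
Proof.
rewrite big_mkcond (bigD1 (None : word l.+1)) //=; congr (_ + _).
  by case: ifP; rewrite ?mul1n.
rewrite (reindex_omap (Some : _ -> word l.+1) id) /=; last by case.
rewrite (eq_bigl predT) => [|x]; last by rewrite eqxx.
under [RHS]eq_bigr do rewrite big_mkcond /=.
rewrite pair_bigA /=; apply: eq_bigr => -[i x] _ /=.
by rewrite inE.
Qed.

Lemma card_word l (S : {set word l.+1}) :
  #|S| = ((None : word l.+1) \in S) + \sum_i #|branch S i|.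
Proof.
rewrite -sum1_card big_word muln1; congr (_ + _).
by apply: eq_bigr => i _; rewrite sum1_card.
Qed.

Lemma leavesE l (S : {set word l}) : leaves S = \sum_(x in S) (depth x == l).
Proof.
rewrite /leaves -sum1_card big_mkcond [RHS]big_mkcond /=.
by apply: eq_bigr => x _; rewrite inE; case: (_ \in _) (_ == _) => [] [].
Qed.

Lemma leaves_glue l (S : 'I_delta -> {set word l}) :
  leaves (glue S) = \sum_i leaves (S i).
Proof.
rewrite leavesE big_word inE mul0n add0n; apply: eq_bigr => i _.
by rewrite branch_glue leavesE.
Qed.

(** The distance from [(i, x)] to a vertex outside branch [i] depends on [x] only through
    [depth x]. *)
Lemma wcnt_branch l (S : {set word l.+1}) i (x : word l) d :
  wcnt (Some (i, x) : word l.+1) S d =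
  ((None : word l.+1) \in S) * ((depth x).+1 == d) + wcnt x (branch S i) d
  + \sum_(j | j != i) \sum_(y in branch S j) ((depth x + depth y).+2 == d).
Proof.
rewrite /wcnt big_word -addnA; congr (_ + _).
rewrite (bigD1 i) //=; congr (_ + _).
  by apply: eq_bigr => y _; rewrite eqxx.
apply: eq_bigr => j /negPf ji; apply: eq_bigr => y _.
by rewrite /= (eq_sym i) ji.
Qed.

Lemma wcnt_gt0 l (x y : word l) (S : {set word l}) :
  y \in S -> 0 < wcnt x S (wdist x y).
Proof. by move=> yS; rewrite /wcnt (bigD1 y) //= eqxx. Qed.

(** * Twin leaves and what a resolving set must hit *)

Definition twins l (x y : word l) : Prop :=
  [/\ x != y, depth x = l, depth y = l &
      forall z, z != x -> z != y -> wdist x z = wdist y z].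

(** A consequence of resolving that passes to branches directly, before a branch is known to be
    resolving. *)
Definition twin_hitting l (S : {set word l}) : Prop :=
  forall x y, twins x y -> (x \in S) || (y \in S).

Lemma wres_twin_hitting l (S : {set word l}) : wres S -> twin_hitting S.
Proof.
move=> rS x y [xy _ _ txy]; apply/negPn/negP; rewrite negb_or => /andP[xS yS].
move/eqP: xy; apply; apply: rS => // d; apply: eq_bigr => z zS.
by rewrite txy //; apply: contraTneq zS => ->.
Qed.

Lemma twins_branch l (x y : word l) (i : 'I_delta) :
  twins x y -> twins (Some (i, x) : word l.+1) (Some (i, y) : word l.+1).
Proof.
move=> [xy dx dy txy]; split=> /=; rewrite ?dx ?dy //.
  by apply: contra xy => /eqP[->].
case=> [[j z]|] zx zy //=.
case: ifP => // /eqP ij; subst j; apply: txy.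
  by apply: contra zx => /eqP->.
by apply: contra zy => /eqP->.
Qed.

Lemma twin_hitting_branch l (S : {set word l.+1}) i :
  twin_hitting S -> twin_hitting (branch S i).
Proof. by move=> hS x y /twins_branch-/(_ i)/hS; rewrite !inE. Qed.

Lemma twins_depth1 (i j : 'I_delta) : i != j ->
  twins (Some (i, tt) : word 1) (Some (j, tt) : word 1).
Proof.
move=> ij; split=> //; first by apply: contra ij => /eqP[->].
case=> [[k []]|] //= ki kj.
rewrite ifN; last by apply: contra ki => /eqP->.
by rewrite ifN //; apply: contra kj => /eqP->.
Qed.

Hypothesis delta_gt1 : 1 < delta.

Lemma other_letter (i : 'I_delta) : exists j, j != i.
Proof.
have [i0|i0] := eqVneq (i : nat) 0.
  by exists (Ordinal delta_gt1); rewrite -val_eqE /= i0.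
by exists (Ordinal (ltnW delta_gt1)); rewrite -val_eqE /= eq_sym.
Qed.

Lemma twins_ex l : exists x y : word l.+1, twins x y.
Proof.
elim: l => [|l [x [y txy]]].
  have [j ji] := other_letter (Ordinal delta_gt1).
  exists (Some (j, tt)); exists (Some (Ordinal delta_gt1, tt)).
  exact: twins_depth1.
exists (Some (Ordinal delta_gt1, x)); exists (Some (Ordinal delta_gt1, y)).
exact: twins_branch.
Qed.

Definition leaf_hitting l (S : {set word l}) : Prop :=
  exists2 x, x \in S & depth x = l.

Lemma twin_hitting_leaf l (S : {set word l.+1}) :
  twin_hitting S -> leaf_hitting S.
Proof.
have [x [y txy]] := twins_ex l; case: (txy) => _ dx dy _.
by move/(_ _ _ txy)/orP=> [xS|yS]; [exists x|exists y].
Qed.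

(* Equivalently, the distance from any non-root vertex outside [S] to [S] reaches
   the eccentricity of that vertex. *)
Definition far_hitting l (S : {set word l.+1}) : Prop :=
  forall i (x : word l), (Some (i, x) : word l.+1) \notin S ->
  exists2 j, j != i & leaf_hitting (branch S j).

Lemma twin_hitting_far l (S : {set word l.+1}) :
  twin_hitting S -> far_hitting S.
Proof.
move=> hS i x xS; have [j ji] := other_letter i; exists j => //.
(* A branch of positive height contains twins of its own; a branch of height 0 is a single leaf, a
   sibling of [x]. *)
case: l S x hS xS => [S [] hS xS|l S x hS _]; last first.
  exact/twin_hitting_leaf/twin_hitting_branch.
exists tt => //; rewrite inE.
by have := hS _ _ (twins_depth1 ji); rewrite (negPf xS) orbF.
Qed.

(** A leaf of [S] in another branch is at distance depth plus height from the deeper vertex; nothing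
    is that far from the shallower one. *)
Lemma far_hitting_depth l (S : {set word l.+1}) (x y : word l.+1) :
  far_hitting S -> x \notin S -> y \notin S ->
  wcnt x S =1 wcnt y S -> depth x = depth y.
Proof.
move=> hS; wlog xy : x y / depth x <= depth y => [W xS yS e|xS yS e].
  case/orP: (leq_total (depth x) (depth y)) => h; first exact: W.
  by apply/esym/W.
apply/eqP; rewrite eqn_leq xy andTb leqNgt; apply/negP => lt_xy.
case: y yS e lt_xy {xy} => [[i y]|] // yS e lt_xy.
have [j ji [z]] := hS _ _ yS; rewrite inE => zS dz.
have := wcnt_gt0 (Some (i, y) : word l.+1) zS.
rewrite -e /wcnt lt0n sum_nat_eq0.
move/negP; apply; apply/forallP=> t; apply/implyP=> _; rewrite eqb0.
apply/negP => /eqP; rewrite [RHS]/= (eq_sym i) (negPf ji) dz => ed.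
have := wdist_le x t; have := depth_le t.
by move: lt_xy ed; rewrite [X in _ < X]/=; lia.
Qed.

Lemma wres_branch l (S : {set word l.+2}) i : wres S -> wres (branch S i).
Proof.
move=> rS x y xS yS e; have hS := wres_twin_hitting rS.
(* The branch has positive height, so its own representations determine depths; the contributions
   from outside the branch then agree. *)
have dxy : depth x = depth y.
  apply: (far_hitting_depth _ xS yS e).
  exact/twin_hitting_far/twin_hitting_branch.
suff [] : (Some (i, x) : word l.+2) = Some (i, y) by [].
apply: rS; [by rewrite inE in xS|by rewrite inE in yS|] => d.
by rewrite !wcnt_branch e dxy.
Qed.

Lemma wres_glue l (S : 'I_delta -> {set word l.+1}) :
  (forall i, wres (S i)) -> injective (fun i => leaves (S i)) ->
  wres (glue S).
Proof.
move=> rS injS x y xS yS e.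
have hS : far_hitting (glue S).
  move=> i _ _; have [j ji] := other_letter i; exists j => //.
  by rewrite branch_glue; apply/twin_hitting_leaf/wres_twin_hitting.
(* From branch [k], the distance depth plus height is attained in [glue S] exactly at the leaves of
   the other branches: inside the branch, distances are smaller by at least 2. *)
have far (k : 'I_delta) (z : word l.+1) :
    wcnt (Some (k, z) : word l.+2) (glue S) (depth z + l.+1).+2
    + leaves (S k) = \sum_i leaves (S i).
  rewrite wcnt_branch inE mul0n add0n branch_glue.
  rewrite [X in X + _ + _](_ : _ = 0) ?add0n; last first.
    apply/eqP; rewrite sum_nat_eq0; apply/forallP=> t; apply/implyP=> _.
    rewrite eqb0; apply/eqP => ed.
    have := wdist_le z t; have := depth_le t; rewrite ed; lia.
  rewrite [RHS](bigD1 k) //= addnC; congr (_ + _); apply: eq_bigr => m _.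
  rewrite leavesE branch_glue; apply: eq_bigr => t _.
  by rewrite !eqSS eqn_add2l.
have := far_hitting_depth hS xS yS e.
(* By equality of depths, if one vertex is the root, so is the other. *)
case: x xS e => [[i x]|] xS e; last by case: y {e yS} => [[]|].
case: y yS e => [[j y]|] yS e // [dxy0].
have dxy : @depth l.+1 x = @depth l.+1 y by [].
rewrite !inE in xS yS.
have ij : i = j.
  apply: injS; apply/eqP.
  rewrite -(eqn_add2l (wcnt (Some (i, x) : word l.+2)
    (glue S) (@depth l.+1 x + l.+1).+2)) far e dxy far //.
subst j; rewrite (rS i x y) // => d.
have := e d; rewrite !wcnt_branch inE !mul0n !add0n dxy branch_glue.
exact: addIn.
Qed.

(** * Recursion for the dimension *)

Definition wdim l m := (exists2 S : {set word l}, wres S & #|S| = m) /\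
  (forall S : {set word l}, wres S -> m <= #|S|).

(** Together with [wdim l m], these sets are bases; leaf counts stand for the multiplicities of the
    root's eccentricity. *)
Definition wsep l m := exists S : 'I_delta.+1 -> {set word l},
  [/\ forall i, wres (S i), forall i, #|S i| = m &
      injective (fun i => leaves (S i))].

Lemma wdim_step l m : wdim l.+1 m -> wsep l.+1 m ->
  wdim l.+2 (delta * m) /\ wsep l.+2 (delta * m).
Proof.
move=> [_ minS] [S [rS cS injS]].
(* [lift j] enumerates the indices other than [j], so [S' j] omits the set [S j]. *)
pose S' (j : 'I_delta.+1) := glue (fun i => S (lift j i)).
have rS' j : wres (S' j).
  by apply: wres_glue => // i k /injS /lift_inj.
have cS' j : #|S' j| = delta * m.
  rewrite card_word inE add0n (eq_bigr (fun=> m)) => [|i _].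
    by rewrite sum_nat_const card_ord.
  by rewrite branch_glue.
split; first split; first by exists (S' ord0).
  move=> U rU; rewrite card_word; apply: leq_trans (leq_addl _ _).
  have -> : delta * m = \sum_(i < delta) m by rewrite sum_nat_const card_ord.
  by apply: leq_sum => i _; apply/minS/wres_branch.
exists S'; split=> // i j; rewrite !leaves_glue => e; apply: injS.
(* The leaf count of [S' k] is a fixed total minus that of [S k], so distinct omissions give
   distinct counts. *)
have sumE k : leaves (S k) + \sum_(m < delta) leaves (S (lift k m))
    = \sum_k leaves (S k) by rewrite [RHS](bigD1_ord k).
by have /eqP := sumE i; rewrite -(sumE j) e eqn_add2r => /eqP.
Qed.

Lemma wdim_iter l m k : wdim l.+1 m -> wsep l.+1 m ->
  wdim (k + l.+1) (delta ^ k * m).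
Proof.
move=> dm sm; suff [] : wdim (k + l).+1 (delta ^ k * m) /\
    wsep (k + l).+1 (delta ^ k * m) by rewrite addnS.
elim: k => [|k [dk sk]]; first by rewrite mul1n.
by rewrite expnS -mulnA; apply: wdim_step.
Qed.

End Words.

(** With one letter the depth determines the vertex, so the root alone resolves; the empty set gives
    two distinct vertices the same empty representation. *)
Lemma wdim_path l : wdim 1 l.+1 1.
Proof.
have inj k (x y : word 1 k) : depth x = depth y -> x = y.
  elim: k x y => [[][]|k IH [[i x]|] [[j y]|]] //= [] /IH ->.
  by rewrite !ord1.
split; last first.
  move=> S rS; rewrite lt0n cards_eq0; apply/eqP => S0.
  have := rS None (Some (ord0, wroot 1 l)); rewrite S0 !inE.
  by move=> /(_ isT isT)H; have: (None : word 1 l.+1) = Some (ord0, wroot 1 l)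
    by apply: H => d; rewrite /wcnt !big_set0.
exists [set wroot 1 l.+1]; last by rewrite cards1.
move=> x y _ _ e; apply: inj.
have := e (depth x); rewrite /wcnt !big_set1 !wdist_root eqxx.
by case: eqP.
Qed.

(** * Full trees are isomorphic to the word model *)

Section Distance.
Variable G : sgraph.
Implicit Types (u v x y z : G) (p : seq G).

Lemma bigminn_le (I : eqType) (r : seq I) (P : pred I) (F : I -> nat) m k :
  k \in r -> P k -> \big[minn/m]_(i <- r | P i) F i <= F k.
Proof.
move=> + Pk; elim: r => //= i r IH; rewrite inE big_cons.
case/predU1P=> [<-|/IH le_k]; first by rewrite Pk geq_minl.
by case: ifP => // _; rewrite geq_min le_k orbT.
Qed.

Lemma dist_le u p : path (@adj G) u p -> dist u (last u p) <= size p.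
Proof.
move=> pp; case: (shortenP pp) => q pq uq sq.
(* The minimum defining [dist] ranges over lengths below [#|G|], which a duplicate-free path
   respects. *)
have szq : size q < #|G|.
  by rewrite -[(size q).+1]/(size (u :: q)) -(card_uniqP uq) max_card.
have le_qp : size q <= size p by apply: uniq_leq_size sq; case/andP: uq.
apply: leq_trans le_qp.
apply: (bigminn_le _ _ (k := Ordinal szq)); first by rewrite mem_index_enum.
by apply/existsP; exists (in_tuple q); rewrite /is_path pq eqxx.
Qed.

Lemma dist_path u v : connect (@adj G) u v ->
  exists p, [/\ path (@adj G) u p, last u p = v & size p = dist u v].
Proof.
case/connectP=> p0 pp0 def_v.
have lt_dist : dist u v < #|G|.
  case: (shortenP pp0) def_v => q pq uq _ ->.
  apply: leq_ltn_trans (dist_le pq) _.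
  by rewrite -[(size q).+1]/(size (u :: q)) -(card_uniqP uq) max_card.
move: lt_dist; rewrite /dist.
(* The premise [m < #|G|] makes the claim vacuous at the default value of the minimum. *)
apply: (big_ind (fun m => m < #|G| ->
  exists p, [/\ path (@adj G) u p, last u p = v & size p = m])).
- by rewrite ltnn.
- by move=> a b Ha Hb; rewrite /minn; case: ifP.
move=> k /existsP[p /and3P[pp /eqP lp _]] _.
by exists p; rewrite size_tuple.
Qed.

(** Descending from [y] by the last condition builds a path of length [d x y]; by the edge condition
    [d] grows by at most one per edge, so no path is shorter. *)
Lemma dist_unique (d : G -> G -> nat) :
  (forall x, d x x = 0) ->
  (forall x y, d x y = 0 -> x = y) ->
  (forall x y z, adj y z -> d x z <= (d x y).+1) ->
  (forall x y, x != y -> exists2 z, adj z y & (d x z).+1 = d x y) ->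
  forall x y, dist x y = d x y.
Proof.
move=> d0 d0_eq d_adj d_pred x y.
have [p [pp lp sp]] : exists p,
    [/\ path (@adj G) x p, last x p = y & size p = d x y].
  have [m] := ubnP (d x y); elim: m y => // m IH y le_dm.
  have [<-|/d_pred[z zy dz]] := eqVneq x y; first by exists [::]; rewrite d0.
  have [|p [pp lp sp]] := IH z; first by rewrite dz.
  exists (rcons p y).
  by rewrite rcons_path pp lp zy last_rcons size_rcons sp dz.
have /dist_path[q [pq lq sq]] : connect (@adj G) x y.
  by apply/connectP; exists p.
apply/eqP; rewrite eqn_leq; apply/andP; split.
  by rewrite -sp -lp dist_le.
rewrite -sq -lq; elim/last_ind: q pq {lq sq} => [|q z IH]; first by rewrite d0.
rewrite rcons_path last_rcons size_rcons => /andP[/IH le_q qz].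
exact: leq_trans (d_adj _ _ _ qz) _.
Qed.

Hypothesis cG : connected G.

Lemma dist_refl u : dist u u = 0.
Proof. by apply/eqP; rewrite -leqn0 (@dist_le u [::]). Qed.

Lemma dist_eq0 u v : dist u v = 0 -> u = v.
Proof.
by have [p [_ + <-]] := dist_path (cG u v) => + /size0nil p0; rewrite p0.
Qed.

Lemma dist_adj x y z : adj y z -> dist x z <= (dist x y).+1.
Proof.
move=> yz; have [p [pp lp <-]] := dist_path (cG x y).
have := @dist_le x (rcons p z).
by rewrite rcons_path pp lp yz last_rcons size_rcons; apply.
Qed.

Lemma dist_pred x y : x != y -> exists2 z, adj z y & (dist x z).+1 = dist x y.
Proof.
move=> xy; have [p [+ + sp]] := dist_path (cG x y); rewrite -sp.
case/lastP: p sp => [_ _ /= e|p z]; first by rewrite e eqxx in xy.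
rewrite last_rcons rcons_path size_rcons => + /andP[pp az] ez; subst z => sp.
exists (last x p) => //; apply/eqP; rewrite eqSS eqn_leq dist_le //=.
by rewrite -ltnS sp dist_adj.
Qed.

End Distance.

(** * Structure of a full tree and its labelling by words *)

Section Tree.
Variables (delta l : nat) (G : rooted_graph).
Hypotheses (l_gt0 : 0 < l) (fG : full_ary_tree delta l G).

Notation r := (root_of G).
Notation dep := (dist (root_of G)).

Let cG : connected G. Proof. by case: fG => [[]]. Qed.

(** Without neighbours the root would be a leaf, forcing depth 0. *)
Lemma full_ary_delta_gt0 : 0 < delta.
Proof.
case: fG => _ dr leafl _; rewrite lt0n; apply/eqP => d0.
have := leafl r; rewrite /is_leaf dr d0 !eqxx dist_refl => /(_ isT) l0.
by move: l_gt0; rewrite -l0.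
Qed.

(* Two neighbours of [v] that are both no deeper than [v] would be joined by a
   path through the root avoiding [v]; with [v] it closes into a cycle. *)
Lemma parent_unique (v p q : G) :
  adj v p -> adj v q -> dep p <= dep v -> dep q <= dep v -> p = q.
Proof.
move=> vp vq dp dq; apply/eqP/negPn/negP => pq.
have nadj (x y : G) : adj x y -> x != y.
  by move=> xy; apply/eqP=> e; rewrite e adj_irr in xy.
have vr : v != r.
  apply/eqP => vr; move: dp (nadj _ _ vp).
  by rewrite vr dist_refl leqn0 => /eqP/(dist_eq0 cG) ->; rewrite eqxx.
(* [e] is adjacency in the graph with [v] deleted. *)
pose e := [rel a b : G | [&& adj a b, a != v & b != v]].
have sym_e : symmetric e.
  by move=> a b /=; rewrite adj_sym; congr (_ && _); rewrite andbC.
(* Each step towards the root lowers the depth strictly below that of [v], so [v] is never met. *)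
have to_r x : x != v -> dep x <= dep v -> connect e r x.
  have [m] := ubnP (dep x); elim: m x => // m IH x le_m xv le_v.
  have [<-|rx] := eqVneq r x; first exact: connect0.
  have [z zx dz] := dist_pred cG rx.
  have zv : z != v by apply/eqP => zv; rewrite -zv in le_v; lia.
  apply: connect_trans (IH z _ zv _) (connect1 _); [lia|lia|].
  by rewrite /= zx zv.
have pv : p != v by rewrite eq_sym nadj.
have qv : q != v by rewrite eq_sym nadj.
have : connect e p q.
  apply: (connect_trans _ (to_r q qv dq)).
  by rewrite (sym_connect_sym sym_e) to_r.
case/connectP=> s0 ps0 def_q; case: (shortenP ps0) def_q => s ps us _ def_q.
case: fG => [[_ acyc] _ _ _].
have pas : path (@adj G) p s by apply: sub_path ps => a b /= /and3P[].
have vs : v \notin s.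
  have : all (fun a => a != v) s.
    elim: s p ps {vp dp pq pv us def_q pas ps0} => //= a s IH p.
    by case/andP=> /and3P[_ _ ->] /IH.
  by move/allP=> h; apply/negP => /h; rewrite eqxx.
(* The cycle through [v], [p] and [s] has at most two vertices, so [s] is empty and [p = q]. *)
have : size [:: v, p & s] <= 2.
  apply: acyc; rewrite /ucycle /= rcons_path vp pas -def_q (adj_sym q) vq /=.
  by rewrite inE eq_sym (negPf pv) vs; exact: us.
case: s def_q {ps us pas vs} => //= def_q _.
by rewrite def_q eqxx in pq.
Qed.

Definition kids (v : G) : {set G} := [set u | adj v u & dep u == (dep v).+1].

Lemma adj_dep (v p q : G) : adj v p -> dep p <= dep v -> adj v q -> q != p ->
  q \in kids v.
Proof.
move=> vp dp vq qp; rewrite inE vq eqn_leq dist_adj //= ltnNge.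
by apply: contra qp => dq; rewrite (parent_unique vq vp).
Qed.

Lemma parent_exists (v : G) : v != r -> exists2 p, adj v p & (dep p).+1 = dep v.
Proof.
rewrite eq_sym => /(dist_pred cG)[p pv dp]; exists p => //.
by rewrite adj_sym.
Qed.

Lemma card_kids (v : G) : v != r -> degree v = delta.+1 -> #|kids v| = delta.
Proof.
move=> vr dv; have [p vp dp] := parent_exists vr.
have pk : p \notin kids v by rewrite inE -dp; lia.
apply: succn_inj; rewrite -dv /degree -[LHS]add1n.
rewrite (_ : [set u | adj v u] = p |: kids v) ?cardsU1 ?pk //.
apply/setP=> q; rewrite in_setU1 [LHS]inE.
have [->|qp] := eqVneq q p; first by [].
apply/idP/idP => [vq|]; last by rewrite inE => /andP[].
by apply: adj_dep vp _ vq qp; rewrite -dp.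
Qed.

Lemma card_kids_root : #|kids r| = delta.
Proof.
case: fG => _ <- _ _; congr (#|pred_of_set _|); apply/setP=> u; rewrite !inE.
case: (boolP (adj r u)) => //= ru; rewrite dist_refl.
rewrite eqn_leq -{1}(dist_refl r) dist_adj //= lt0n.
apply/eqP => /(dist_eq0 cG) ru0; by rewrite -ru0 adj_irr in ru.
Qed.

(** A deepest vertex has no children, so it is the root or a leaf. *)
Lemma dep_le (u : G) : dep u <= l.
Proof.
case: (arg_maxnP (P := predT) (fun v : G => dep v) (i0 := r) isT) => v _ maxv.
apply: leq_trans (maxv u isT) _.
have [->|vr] := eqVneq v r; first by rewrite dist_refl.
case: (fG) => _ _ leafl /(_ v vr)[/leafl -> //|dv].
have /card_gt0P[w] : 0 < #|kids v| by rewrite card_kids // full_ary_delta_gt0.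
by rewrite inE => /andP[_ /eqP dw]; have := maxv w isT; rewrite /= dw ltnn.
Qed.

Lemma card_kids_lt (v : G) : dep v < l -> #|kids v| = delta.
Proof.
move=> lt_v; have [->|vr] := eqVneq v r; first exact: card_kids_root.
case: (fG) => _ _ leafl /(_ v vr)[/leafl dv|]; last exact: card_kids.
by rewrite dv ltnn in lt_v.
Qed.

(** The default [v] is never reached when [dep v < l], since [v] then has [delta] children. *)
Definition kid (v : G) (i : 'I_delta) : G := nth v (enum (kids v)) i.

Lemma kidP (v : G) i : dep v < l -> kid v i \in kids v.
Proof.
by move=> lt_v; rewrite -mem_enum mem_nth // -cardE card_kids_lt.
Qed.

Lemma kid_inj (v : G) : dep v < l -> injective (kid v).
Proof.
move=> lt_v i j /eqP; rewrite nth_uniq ?enum_uniq -?cardE ?card_kids_lt //.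
by move/eqP/val_inj.
Qed.

Lemma kid_surj (v u : G) : dep v < l -> u \in kids v -> exists i, kid v i = u.
Proof.
move=> lt_v uv; have lt_i : index u (enum (kids v)) < delta.
  by rewrite -(card_kids_lt lt_v) cardE index_mem mem_enum.
by exists (Ordinal lt_i); rewrite /kid nth_index // mem_enum.
Qed.

Lemma kids_parent (u v w : G) : w \in kids u -> w \in kids v -> u = v.
Proof.
rewrite !inE => /andP[uw /eqP du] /andP[vw /eqP dv].
by apply: (@parent_unique w); rewrite 1?adj_sym //; lia.
Qed.

Definition parent (v : G) : G := odflt v [pick u | v \in kids u].

Lemma parentE (u v : G) : v \in kids u -> parent v = u.
Proof.
rewrite /parent => vu; case: pickP => [w vw|/(_ u)]; last by rewrite vu.
exact: kids_parent vw vu.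
Qed.

Fixpoint emb k (v : G) : word delta k -> G :=
  match k return word delta k -> G with
  | 0 => fun=> v
  | k'.+1 => fun x => if x is Some (i, x') then emb (kid v i) x' else v
  end.

Lemma emb_root k v : emb v (wroot delta k) = v. Proof. by case: k. Qed.

Lemma dep_kid (v : G) i : dep v < l -> dep (kid v i) = (dep v).+1.
Proof. by move/(kidP i); rewrite inE => /andP[_ /eqP]. Qed.

Lemma dep_emb k v (x : word delta k) :
  dep v + k = l -> dep (emb v x) = dep v + depth x.
Proof.
elim: k v x => [|k IH] v x /=; first by rewrite addn0.
case: x => [[i x]|] dv; last by rewrite addn0.
have dk : dep (kid v i) = (dep v).+1 by rewrite dep_kid //; lia.
by rewrite IH dk; lia.
Qed.

Lemma iter_parent_emb k v (x : word delta k) :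
  dep v + k = l -> iter (depth x) parent (emb v x) = v.
Proof.
elim: k v x => [//|k IH] v [[i x]|] //= dv.
have lt_v : dep v < l by lia.
by rewrite IH ?dep_kid //; [exact/parentE/kidP|lia].
Qed.

Lemma emb_inj k v : dep v + k = l -> injective (@emb k v).
Proof.
elim: k v => [v _ [] [] //|k IH v dv x y exy].
have := dep_emb y dv; rewrite -exy dep_emb // => /addnI.
have lt_v : dep v < l by lia.
have dk i : dep (kid v i) + k = l by rewrite dep_kid //; lia.
case: x y exy => [[i x]|] [[j y]|] //= exy [dxy].
(* Climbing from the common image by the common remaining depth leads to the child named by either
   first letter, so these agree. *)
have := iter_parent_emb y (dk j); rewrite -exy -dxy iter_parent_emb //.
by move/kid_inj=> ij; move: exy; rewrite ij // => /IH ->.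
Qed.

Lemma emb_child k v (x y : word delta k) :
  dep v + k = l -> child x y -> emb v y \in kids (emb v x).
Proof.
elim: k v x y => [//|k IH] v x y dv.
have lt_v : dep v < l by lia.
case: x y => [[i x]|] [[j y]|] //=.
  by case/andP=> /eqP <- /IH-> //; rewrite dep_kid //; lia.
by move/eqP->; rewrite emb_root kidP.
Qed.

Lemma emb_kid k v (x : word delta k) i :
  depth x < k -> exists y : word delta k, emb v y = kid (emb v x) i.
Proof.
elim: k v x => [//|k IH] v [[j x]|] /=.
  by rewrite ltnS => /(IH (kid v j))[y <-]; exists (Some (j, y)).
by exists (Some (i, wroot delta k)); rewrite emb_root.
Qed.

Lemma emb_surj u : exists x, @emb l r x = u.
Proof.
have dr : dep r + l = l by rewrite dist_refl.
have [m] := ubnP (dep u); elim: m u => // m IH u le_m.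
have [->|ur] := eqVneq u r; first by exists (wroot delta l); rewrite emb_root.
have [p up dp] := parent_exists ur.
have [|x ex] := IH p; first lia.
have lt_p : dep p < l by have := dep_le u; lia.
have [i ei] : exists i, kid p i = u.
  by apply: kid_surj => //; rewrite inE adj_sym up dp /=.
have [|y ey] := @emb_kid l r x i.
  by have := dep_emb x dr; rewrite ex dist_refl add0n => <-.
by exists y; rewrite ey ex.
Qed.

Lemma full_ary_tree_iso : exists f : word delta l -> G,
  [/\ bijective f, f (wroot delta l) = r &
      forall x y, dist (f x) (f y) = wdist x y].
Proof.
have dr : dep r + l = l by rewrite dist_refl.
pose f := @emb l r; have injf : injective f by apply: emb_inj.
have gP u : exists x, f x == u by have [x <-] := emb_surj u; exists x.
pose g u := xchoose (gP u).
have gK : cancel g f by move=> u; apply/eqP/(xchooseP (gP u)).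
have fK : cancel f g by move=> x; apply: injf; rewrite gK.
have child_adj x y : child x y -> adj (f x) (f y).
  by move/(emb_child dr); rewrite inE => /andP[].
(* The parent of [g v] in the word model is mapped to a parent of [v], which is unique. *)
have kids_child u v : v \in kids u -> child (g u) (g v).
  move=> uv; have gv : g v != wroot delta l.
    apply: contraTneq uv => gv; rewrite inE negb_and.
    by rewrite -(gK v) gv [f _]emb_root dist_refl orbT.
  have [z cz] := parent_ex gv.
  have := emb_child dr cz; rewrite -/(f _) -/(f _) gK => /(kids_parent uv) ->.
  by rewrite fK.
exists f; split; [by exists g|exact: emb_root|].
move=> x y; rewrite (@dist_unique G (fun u v => wdist (g u) (g v))) ?fK //.
- by move=> u; rewrite wdist_refl.
- by move=> u v /wdist_eq0/(can_inj gK).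
- move=> u v w vw.
  have : child (g v) (g w) \/ child (g w) (g v).
    (* Depth orients the edge; a neighbour [w] no deeper than [v] must be the parent of [v]. *)
    have [dwv|dvw] := leqP (dep w) (dep v).
      right; apply: kids_child; rewrite inE adj_sym vw /=.
      have [vr|vr] := eqVneq v r.
        move: dwv; rewrite vr dist_refl leqn0 => /eqP/(dist_eq0 cG) wr.
        by rewrite vr -wr adj_irr in vw.
      have [p vp dp] := parent_exists vr.
      by rewrite -dp (parent_unique vw vp) // -dp.
    left; apply: kids_child; rewrite inE vw eqn_leq dvw andbT.
    exact: dist_adj.
  by case=> /(child_wdist (g u)); lia.
move=> u v uv; have guv : g u != g v by rewrite (can_eq gK).
have [z cz dz] := wdist_pred guv; exists (f z); last by rewrite fK.
rewrite -(gK v); case/orP: cz => /child_adj //.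
by rewrite adj_sym.
Qed.

End Tree.

(** * Transport of resolving sets *)

Section Transport.
Variables (delta l : nat) (G : rooted_graph).
Hypotheses (l_gt0 : 0 < l) (fG : full_ary_tree delta l G).

Lemma mrep_cnt (u : G) (S : {set G}) d :
  mrep u S d = \sum_(x in S) (dist u x == d).
Proof.
rewrite /mrep mset_seqE count_map -sum1_count big_mkcond /=.
by rewrite big_enum; apply: eq_bigr => x _; case: (_ == d).
Qed.

Variable f : word delta l -> G.
Hypotheses (bij_f : bijective f) (f_root : f (wroot delta l) = root_of G)
  (f_dist : forall x y, dist (f x) (f y) = wdist x y).

Lemma mrep_iso x (S : {set G}) d : mrep (f x) S d = wcnt x (f @^-1: S) d.
Proof.
rewrite mrep_cnt (reindex f) /=; last exact: onW_bij.
by apply: eq_big => [y|y _]; rewrite ?inE ?f_dist.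
Qed.

Lemma resolving_iso (S : {set G}) : oms_resolving S <-> wres (f @^-1: S).
Proof.
have [g fK gK] := bij_f; split=> [/forallP rS x y|rS].
  rewrite !inE => xS yS e; apply/eqP/negPn/negP => xy.
  move: (rS (f x)) => /forallP/(_ (f y)); rewrite xS yS (can_eq fK) xy /=.
  by move/eqP; apply; apply/msetP => d; rewrite !mrep_iso.
apply/forallP=> u; apply/forallP=> v; apply/implyP=> /and3P[uS vS uv].
apply: contra uv => /eqP e; rewrite -(can_eq gK); apply/eqP.
by apply: rS; rewrite ?inE ?gK // => d; rewrite -!mrep_iso !gK e.
Qed.

Lemma preimset_surj (U : {set word delta l}) :
  exists S : {set G}, f @^-1: S = U.
Proof.
by exists (f @: U); apply/setP=> x; rewrite inE mem_imset //; apply: bij_inj.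
Qed.

Lemma card_iso (S : {set G}) : #|f @^-1: S| = #|S|.
Proof. exact/on_card_preimset/onW_bij. Qed.

Lemma wdim_iso : wdim delta l (dim_ms G).
Proof.
have [[S rS cS] minS] := dim_msP G; split.
  by exists (f @^-1: S); [exact/resolving_iso|rewrite card_iso].
move=> U; have [W <-] := preimset_surj U; move/resolving_iso/minS.
by rewrite card_iso.
Qed.

Lemma ecc_root : 0 < delta -> ecc (root_of G) = l.
Proof.
move=> delta_gt0; apply/eqP; rewrite eqn_leq; apply/andP; split.
  apply/bigmax_leqP => u _; exact: (dep_le l_gt0 fG).
have [x dx] : exists x : word delta l, depth x = l.
  elim: l => [|k [x dx]]; first by exists tt.
  by exists (Some (Ordinal delta_gt0, x)) => /=; rewrite dx.
apply: leq_trans (leq_bigmax (f x)).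
by rewrite -f_root f_dist wdistC wdist_root dx.
Qed.

Lemma wsep_iso : has_separated_bases delta G -> wsep delta l (dim_ms G).
Proof.
have d_gt0 := full_ary_delta_gt0 l_gt0 fG.
case=> S [bS sepS]; exists (fun i => f @^-1: S i); split.
- by move=> i; have /andP[/resolving_iso] := bS i.
- by move=> i; have /andP[_ /eqP] := bS i; rewrite card_iso.
(* Distances from the root are depths and its eccentricity is [l], so the separating multiplicity
   counts leaves. *)
have leavesS i : leaves (f @^-1: S i) =
    mrep (root_of G) (S i) (ecc (root_of G)).
  rewrite ecc_root // -f_root mrep_iso leavesE; apply: eq_bigr => x _.
  by rewrite wdistC wdist_root.
move=> i j; rewrite !leavesS => e; apply/eqP/negPn/negP => ij.
exact: (sepS i j ij).
Qed.

End Transport.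

(** * Dimension formula for full trees *)

Lemma wdim_unique delta l m m' : wdim delta l m -> wdim delta l m' -> m = m'.
Proof.
move=> [[S rS <-] minS] [[S' rS' <-] minS'].
by apply/eqP; rewrite eqn_leq minS // minS'.
Qed.

Lemma full_ary_tree_wdim delta l (G : rooted_graph) :
  0 < l -> full_ary_tree delta l G -> wdim delta l (dim_ms G).
Proof.
move=> l0 fG; have [f [? ? ?]] := full_ary_tree_iso l0 fG.
exact: (@wdim_iso _ _ _ f).
Qed.

Lemma full_ary_tree_wsep delta l (G : rooted_graph) :
  0 < l -> full_ary_tree delta l G -> has_separated_bases delta G ->
  wsep delta l (dim_ms G).
Proof.
move=> l0 fG; have [f [? ? ?]] := full_ary_tree_iso l0 fG.
exact: (@wsep_iso _ _ _ _ _ f).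
Qed.

Theorem theorem5p3 (delta : nat) (T : nat -> rooted_graph)
    (hT : forall l : nat, 0 < l -> full_ary_tree delta l (T l))
    (n : nat) (n_gt0 : 0 < n)
    (hn : has_separated_bases delta (T n))
    (n_min : forall m : nat, 0 < m -> has_separated_bases delta (T m) -> n <= m)
    (l : nat) (le_nl : n <= l) :
  dim_ms (T l) = delta ^ (l - n) * dim_ms (T n).
Proof.
have l_gt0 := leq_trans n_gt0 le_nl.
have dimn := full_ary_tree_wdim n_gt0 (hT n n_gt0).
have diml := full_ary_tree_wdim l_gt0 (hT l l_gt0).
have sepn := full_ary_tree_wsep n_gt0 (hT n n_gt0) hn.
have := full_ary_delta_gt0 n_gt0 (hT n n_gt0).
(* For [delta = 1] there are no sibling leaves; both dimensions are 1 by [wdim_path]. *)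
rewrite leq_eqVlt => /predU1P[d1|d_gt1].
  have dim1 k m : 0 < k -> wdim delta k m -> m = 1.
    by case: k => // k _ /wdim_unique; apply; rewrite -d1; apply: wdim_path.
  by rewrite -d1 exp1n mul1n (dim1 _ _ l_gt0 diml) (dim1 _ _ n_gt0 dimn).
apply: (wdim_unique diml).
case: n n_gt0 le_nl dimn sepn {hn n_min} => // n _ le_nl dimn sepn.
by have := wdim_iter d_gt1 (l - n.+1) dimn sepn; rewrite subnK.
Qed.
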